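(* Let $\kappa$ be a regular cardinal and $\lambda$ a cardinal with $\lambda^{<\kappa} = \lambda$. Then $\kappa$ has the $\lambda$-filter extension property if and only if the $\mathcal{L}_{\kappa,\kappa}$-compactness property for languages of size $2^\lambda$ holds.
   Context: For a regular cardinal $\kappa$ and a cardinal $\lambda$: $\kappa$ has the $\lambda$-filter extension property if every $\kappa$-complete filter on $\lambda$ can be extended to a $\kappa$-complete ultrafilter on $\lambda$. The $\mathcal{L}_{\kappa,\kappa}$-compactness property for languages of size $\mu$ holds if for every first-order language $\mathcal{L}$ with $\mu$ many non-logical symbols and every collection $\Phi$ of $\mathcal{L}_{\kappa,\kappa}$-sentences in $\mathcal{L}$ (infinitary logic allowing conjunctions/disjunctions of fewer than $\kappa$ formulas and quantification over fewer than $\kappa$ variables), if every subcollection $\Phi' \subseteq \Phi$ with $|\Phi'| < \kappa$ has a model, then $\Phi$ has a model. *)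

(* Defs.v *)
From mathcomp Require Import all_boot all_order.
From mathcomp Require Import boolp classical_sets functions cardinality filter.

Set Implicit Arguments.
Unset Strict Implicit.
Unset Printing Implicit Defensive.

Import Order.TTheory.
Local Open Scope classical_set_scope.
Local Open Scope card_scope.
Local Open Scope order_scope.

Definition card_lt T U (A : set T) (B : set U) : Prop :=
  (A #<= B) /\ ~ (B #<= A).

(* An ordinal is a well-ordered type K; an ordinal alpha < K is an element a
   of K, identified with the initial segment below a. *)
Definition seg (d : Order.disp_t) (K : orderType d) (a : K) : Type :=
  {x : K | x < a}.

(* K is an initial ordinal, i.e. a cardinal, that is infinite and equal to its
   own cofinality. In particular omega is regular. *)
Definition regular_cardinal (d : Order.disp_t) (K : orderType d) : Prop :=
  [/\ well_founded (fun x y : K => x < y),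
      forall a : K, card_lt [set x : K | x < a] [set: K],
      infinite_set [set: K]
    & forall A : set K,
        (forall x : K, exists2 y : K, A y & x <= y) -> A #= [set: K]].

(* The set of all sequences of elements of L of length alpha, for alpha < K:
   its cardinality is L ^ {< K}, which for L with at least two elements is also
   the supremum of the L ^ mu for mu < K. For L a singleton it is K, not 1. *)
Definition seq_lt (d : Order.disp_t) (K : orderType d) (L : Type) : Type :=
  {a : K & seg a -> L}.

Definition complete_system (d : Order.disp_t) (K : orderType d) (L : Type)
    (F : set_system L) : Prop :=
  forall D : set (set L),
    D `<=` F -> card_lt D [set: K] -> F (\bigcap_(A in D) A).

Definition filter_extension_property (d : Order.disp_t) (K : orderType d)
    (L : Type) : Prop :=
  forall F : set_system L, ProperFilter F -> complete_system K F ->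
  exists U : set_system L,
    [/\ UltraFilter U, complete_system K U & F `<=` U].

(* Constants are the function symbols of arity 0. *)
Record language := Language {
  fun_sym : Type;
  rel_sym : Type;
  fun_arity : fun_sym -> nat;
  rel_arity : rel_sym -> nat
}.

Record structure (S : language) := Structure {
  dom :> Type;
  dom_inhabited : inhabited dom;
  fun_interp : forall f : fun_sym S, ('I_(fun_arity f) -> dom) -> dom;
  rel_interp : forall r : rel_sym S, ('I_(rel_arity r) -> dom) -> Prop
}.

Section Logic.
Variables (d : Order.disp_t) (K : orderType d) (S : language).

(* The variables of the logic are indexed by K. *)
Inductive term : Type :=
  | Var (x : K)
  | App (f : fun_sym S) (args : 'I_(fun_arity f) -> term).

(* Conjunctions, disjunctions and quantifier blocks are sequences of length
   alpha < K: [Conj a phi] is /\_(xi < alpha) phi_xi, and [Ex a v phi]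
   is (exists <v_xi : xi < alpha>) phi, the v_xi being variables. *)
Inductive formula : Type :=
  | Equal (t u : term)
  | Rel (r : rel_sym S) (args : 'I_(rel_arity r) -> term)
  | Neg (phi : formula)
  | Conj (a : K) (phi : seg a -> formula)
  | Disj (a : K) (phi : seg a -> formula)
  | All (a : K) (v : seg a -> K) (phi : formula)
  | Ex (a : K) (v : seg a -> K) (phi : formula).

Fixpoint term_var (t : term) : set K :=
  match t with
  | Var x => [set x]
  | App f args => \bigcup_i term_var (args i)
  end.

Fixpoint free_var (phi : formula) : set K :=
  match phi with
  | Equal t u => term_var t `|` term_var u
  | Rel r args => \bigcup_i term_var (args i)
  | Neg phi => free_var phi
  | Conj a phi => \bigcup_i free_var (phi i)
  | Disj a phi => \bigcup_i free_var (phi i)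
  | All a v phi => free_var phi `\` range v
  | Ex a v phi => free_var phi `\` range v
  end.

Definition sentence (phi : formula) : Prop := free_var phi = set0.

Section Semantics.
Variable M : structure S.

Fixpoint eval (s : K -> M) (t : term) : M :=
  match t with
  | Var x => s x
  | App f args => fun_interp (fun i => eval s (args i))
  end.

Definition agree_off (X : set K) (s s' : K -> M) : Prop :=
  forall x : K, ~ X x -> s' x = s x.

Fixpoint sat (s : K -> M) (phi : formula) : Prop :=
  match phi with
  | Equal t u => eval s t = eval s u
  | Rel r args => rel_interp (fun i => eval s (args i))
  | Neg phi => ~ sat s phi
  | Conj a phi => forall i, sat s (phi i)
  | Disj a phi => exists i, sat s (phi i)
  | All a v phi => forall s', agree_off (range v) s s' -> sat s' phi
  | Ex a v phi => exists2 s', agree_off (range v) s s' & sat s' phi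
  end.

End Semantics.

Definition has_model (Phi : set formula) : Prop :=
  exists M : structure S,
    forall phi : formula, Phi phi -> forall s : K -> M, sat s phi.

End Logic.

Definition compactness_property (d : Order.disp_t) (K : orderType d)
    (mu : Type) : Prop :=
  forall S : language, [set: fun_sym S + rel_sym S] #= [set: mu] ->
  forall Phi : set (formula K S), Phi `<=` @sentence d K S ->
    (forall Phi' : set (formula K S),
       Phi' `<=` Phi -> card_lt Phi' [set: K] -> has_model Phi') ->
    has_model Phi.

(* Main.v *)
Require Import Defs.
From mathcomp Require Import all_boot all_order.
From mathcomp Require Import boolp classical_sets functions cardinality filter.

(* From compactness to filters: a model of the propositional theory with one
   atom per subset of L, which asserts the members of F and forbids fewer than
   K sets with empty intersection, is a K-complete ultrafilter extending F.

   From filters to compactness: Henkin terms turn a theory into a system of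
   propositional constraints, each on fewer than K variables. There are at most
   2^L variables, so by Hausdorff's argument and L^{<K} = L there are L many
   valuations realizing every prescription of fewer than K values. The
   valuations satisfying a given constraint generate a K-complete proper filter
   on these L points. Taking the limit of the valuations along a K-complete
   ultrafilter that extends it gives a valuation satisfying all constraints,
   from which a model is read off. *)

Set Implicit Arguments.
Unset Strict Implicit.
Unset Printing Implicit Defensive.

Import Order.TTheory.
Local Open Scope classical_set_scope.
Local Open Scope card_scope.
Local Open Scope order_scope.

(** * Embeddings of types *)

Definition embeds (A B : Type) : Prop := exists f : A -> B, injective f.

Lemma injective_option_inv A B (f : A -> B) :
  injective f -> exists g : B -> option A, forall a, g (f a) = Some a.
Proof.
move=> f_inj.
exists (fun b => if pselect (exists a, f a = b) is left ex
                 then Some (projT1 (cid ex)) else None) => a.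
by case: pselect => [ex|[]]; [case: cid => /= a' /f_inj ->|exists a].
Qed.

Lemma embeds_trans B A C : embeds A B -> embeds B C -> embeds A C.
Proof. by move=> [f fI] [g gI]; exists (g \o f); exact: inj_comp. Qed.

Lemma embeds_prod A A' B B' :
  embeds A A' -> embeds B B' -> embeds (A * B) (A' * B').
Proof.
move=> [f fI] [g gI]; exists (fun p => (f p.1, g p.2)) => -[a b] [a' b'] /=.
by case=> /fI-> /gI->.
Qed.

Lemma embeds_sum A A' B B' :
  embeds A A' -> embeds B B' -> embeds (A + B) (A' + B').
Proof.
move=> [f fI] [g gI].
exists (fun p => match p with inl a => inl (f a) | inr b => inr (g b) end).
by move=> [a|b] [a'|b'] //= [] => [/fI->|/gI->].
Qed.

Lemma embeds_exp A B : embeds A B -> embeds (A -> bool) (B -> bool).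
Proof.
move=> [f fI]; have [g gK] := injective_option_inv fI.
exists (fun X b => if g b is Some a then X a else false) => X Y XY.
by apply/funext => a; have := congr1 (@^~ (f a)) XY; rewrite gK.
Qed.

Lemma embeds_exp_prod A B :
  embeds ((A -> bool) * (B -> bool)) (A + B -> bool).
Proof.
exists (fun p x => match x with inl a => p.1 a | inr b => p.2 b end).
move=> [X Y] [X' Y'] /= e; congr pair; apply/funext => a.
  by have := congr1 (@^~ (inl a)) e.
by have := congr1 (@^~ (inr a)) e.
Qed.

Lemma embeds_singletons A : embeds A (A -> bool).
Proof.
exists (fun a b => `[< a = b >]) => a a' e.
by have := congr1 (@^~ a') e; rewrite (asboolT (erefl a')) => /asboolP.
Qed.

Lemma embeds_card T U : [set: T] #<= [set: U] -> embeds T U.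
Proof.
move=> /card_leP[f]; exists (fun t => val (f (to_setT t))) => t t' /val_inj.
by move=> /inj; rewrite !inE => /(_ I I) /(congr1 val).
Qed.

Lemma embeds_card_le T U : embeds T U -> [set: T] #<= [set: U].
Proof.
move=> [f fI]; have := @inj_card_eq _ _ [set: T] f (in2W fI).
by move=> /card_eqPle[_ /card_le_trans]; apply; exact: card_leT.
Qed.

(** * Sets smaller than a regular cardinal *)

Section Small.
Variables (d : Order.disp_t) (K : orderType d).

(** Only an injection from [K] is excluded; that [X] then injects into [K], which [card_lt] also
    demands, is derived below by enumerating [X]. *)
Definition small T (X : set T) : Prop :=
  ~ exists2 f : K -> T, injective f & forall k, X (f k).

Lemma smallP T (X : set T) : small X <-> ~ ([set: K] #<= X).
Proof.
split; apply: contra_not.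
  move=> /card_leP[f]; exists (fun k => val (f (to_setT k))).
    move=> k k' /val_inj /inj; rewrite !inE.
    by move=> /(_ I I) /(congr1 val).
  by move=> k; rewrite -in_setE; exact: valP.
move=> [f fI fX]; have := @inj_card_eq _ _ [set: K] f (in2W fI).
move=> /card_eqPle[_ /card_le_trans]; apply; apply: subset_card_le.
by move=> _ [k _ <-].
Qed.

Lemma small_image T U (f : T -> U) (X : set T) : small X -> small (f @` X).
Proof.
rewrite !smallP; apply: contra_not => /card_le_trans; apply.
exact: card_image_le.
Qed.

Lemma sub_small T (X Y : set T) : X `<=` Y -> small Y -> small X.
Proof.
by move=> XY; apply: contra_not => -[f fI fX]; exists f => // k; apply: XY.
Qed.

Hypothesis regK : regular_cardinal K.

(** Without a strict bound [A] would be cofinal, hence of size [K] by regularity. *)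
Lemma small_bounded (A : set K) : small A -> exists x, forall y, A y -> y < x.
Proof.
case: regK => _ _ _ reg /smallP smallA; apply: contrapT => unbounded.
apply: smallA; have /card_eqPle[]// : A #= [set: K].
apply: reg => x; apply: contrapT => nx; apply: unbounded.
exists x => y Ay; rewrite ltNge; apply/negP => xy; apply: nx.
by exists y.
Qed.

(** An injection of [K] into the union splits [K] into fibres indexed by [D]. Each fibre is small,
    hence bounded, and these bounds have a common bound [x]; but [x] itself lies in a fibre, below
    the bound of that fibre. *)
Lemma small_bigcup T U (D : set T) (X : T -> set U) :
  small D -> (forall i, D i -> small (X i)) -> small (\bigcup_(i in D) X i).
Proof.
move=> smallD smallX [f fI fX].
have [k0 _] : [set: K] !=set0 by case: regK => _ _ /infinite_setN0.
have /choice[i iP] k : exists i, D i /\ X i (f k).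
  by have [i Di Xi] := fX k; exists i.
have /choice[c cP] j : exists c, D j -> forall k, i k = j -> k < c.
  have [Dj|nDj] := pselect (D j); last first.
    by exists k0.
  have [c cP] : exists c, forall k, i k = j -> k < c; last by exists c.
  apply: (small_bounded (A := [set k | i k = j])) => -[g gI gP].
  apply: (smallX j Dj); exists (f \o g); first exact: inj_comp.
  by move=> k /=; rewrite -(gP k); case: (iP (g k)).
have [x xP] := small_bounded (small_image (f := c) smallD).
have [Dx _] := iP x; have xc := cP _ Dx x erefl.
have /(lt_trans xc) : c (i x) < x by apply: xP; exists (i x).
by rewrite ltxx.
Qed.

Lemma wf_min (A : set K) :
  A !=set0 -> exists2 a, A a & forall x, x < a -> ~ A x.
Proof.
case: regK => wfK _ _ _ [a Aa]; apply: contrapT => noMin.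
elim/(well_founded_ind wfK): a Aa => a IH Aa; apply: noMin.
by exists a.
Qed.

(** Transfinite recursion picks a new element of [X] at each stage. The segment below the first
    stage with none left enumerates [X]; if there is no such stage, [K] injects into [X]. *)
Lemma small_enum T (X : set T) :
  small X -> exists (a : K) (u : seg a -> T), range u = X.
Proof.
move=> smallX; have [wfK _ /infinite_setN0 K0 _] := regK.
have [[t0 Xt0]|X0] := pselect (X !=set0); last first.
  (* The empty set is enumerated by the empty segment below the least element of [K]. *)
  have [a _ amin] := wf_min K0.
  have noseg (i : seg a) : False by case: i => x /amin; apply.
  exists a, (fun i => False_rect T (noseg i)); apply/seteqP; split.
    by move=> t [i]; case: (noseg i).
  by move=> t Xt; case: X0; exists t.
pose fresh (x : K) (f : forall y : K, y < x -> T) : set T :=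
  [set t | X t /\ forall y (yx : y < x), f y yx <> t].
(* The default [t0], for stages where nothing fresh remains, keeps the recursion total. *)
pose F x f : T :=
  if pselect (exists t, fresh x f t) is left ex then projT1 (cid ex) else t0.
pose f := Fix wfK (fun=> T) F.
have fE x : f x = F x (fun y _ => f y).
  rewrite /f Fix_eq// => {}x g h gh; congr (F x).
  by apply: functional_extensionality_dep => y; apply/funext.
have [nofresh|] :=
    pselect ([set x | ~ exists t, fresh x (fun y _ => f y) t] !=set0).
  have [a aP amin] := wf_min nofresh.
  exists a, (fun i => f (sval i)); apply/seteqP; split.
    move=> _ [[x xa] _ <-] /=; have /contrapT[t ft] := amin x xa.
    rewrite fE /F; case: pselect => [ex|[]]; last by exists t.
    by case: cid => ? [].
  move=> t Xt; apply: contrapT => nt; apply: aP; exists t; split => // y ya yt.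
  by apply: nt; exists (exist _ y ya).
move=> allfresh; case: smallX.
have fP x : fresh x (fun y _ => f y) (f x).
  rewrite [f x]fE /F; case: pselect => [ex|nof]; first by case: cid.
  by case: allfresh; exists x.
exists f; last by move=> x; case: (fP x).
move=> x y fxy; apply/eqP; apply: contraT; rewrite neq_lt => /orP[xy|yx].
  by have [_ /(_ x xy)] := fP y.
by have [_ /(_ y yx)] := fP x; rewrite fxy.
Qed.

Lemma small_card_lt T (X : set T) : small X <-> card_lt X [set: K].
Proof.
split=> [smallX|[_ /smallP]//]; split; last exact/smallP.
have [a [u <-]] := small_enum smallX.
apply: card_le_trans (card_image_le _ _) _.
rewrite -(card_le_eql (inj_card_eq (f := @sval K _) _)) ?card_leT//.
by move=> i j _ _ /eq_sig_hprop; apply=> x; exact: Prop_irrelevance.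
Qed.

Lemma small_seg (a : K) : small [set: seg a].
Proof.
case: regK => _ /(_ a)[_ /smallP ltK] _ _; apply: contra_not ltK => -[f fI _].
exists (fun k => sval (f k)); last by move=> k /=; case: (f k).
by move=> k k' /eq_sig_hprop fkk'; apply/fI/fkk' => x; exact: Prop_irrelevance.
Qed.

Lemma finite_small T (X : set T) : finite_set X -> small X.
Proof.
case: regK => _ _ infK _ finX; apply/smallP => KX; apply: infK.
exact: card_le_finite KX finX.
Qed.

Lemma small_setU T (X Y : set T) : small X -> small Y -> small (X `|` Y).
Proof.
move=> smallX smallY.
apply: (@sub_small _ _ (\bigcup_(b in [set: bool]) if b then X else Y)).
  by move=> t [Xt|Yt]; [exists true|exists false].
by apply: small_bigcup; [exact: finite_small|case].
Qed.

End Small.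

Lemma complete_nonempty d (K : orderType d) L (F : set_system L) D :
  ProperFilter F -> complete_system K F -> D `<=` F ->
  card_lt D [set: K] -> (\bigcap_(A in D) A) !=set0.
Proof. by move=> FF Fc DF /(Fc _ DF); exact: filter_ex. Qed.

(** * Compactness implies filter extension *)

Section Membership.
Variables (d : Order.disp_t) (K : orderType d) (L : Type).

Definition mem_language : language :=
  @Language void (set L) (fun=> 0%N) (fun=> 0%N).

(* A is read as "A belongs to the ultrafilter"; k0 is a dummy, since the
   relation symbol is nullary. *)
Definition mem_atom (k0 : K) (A : set L) : formula K mem_language :=
  @Rel d K mem_language A (fun=> Var _ k0).

(** The principal ultrafilter at [x]; the domain is irrelevant to truth, since no symbol takes
    arguments. *)
Definition point_structure (x : L) : structure mem_language :=
  @Structure mem_language unit (inhabits tt) (fun f _ => tt) (fun A _ => A x).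

Lemma card_mem_language :
  [set: fun_sym mem_language + rel_sym mem_language] #= [set: L -> bool].
Proof.
apply/card_eqPle; split; apply: embeds_card_le.
  exists (fun s => match s with
    inl f => match f : void with end | inr A => fun x => `[< A x >] end).
  move=> [[]|A] [[]|B] AB; congr inr; apply/funext => x; apply/propext.
  have e : `[< A x >] = `[< B x >] := congr1 (@^~ x) AB.
  by split=> /asboolP h; apply/asboolP; rewrite (e, =^~ e).
exists (fun X => inr [set x | X x]) => X Y [XY]; apply/funext => x.
by apply/idP/idP; have := congr1 (@^~ x) XY => /= ->.
Qed.

Lemma mem_atom_sentence k0 A : free_var (mem_atom k0 A) = set0.
Proof. by apply/seteqP; split => // x [[]]. Qed.

End Membership.

Lemma filter_extension_of_compactness (d : Order.disp_t) (K : orderType d)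
    (L : Type) : regular_cardinal K ->
  compactness_property K (L -> bool) -> filter_extension_property K L.
Proof.
move=> regK compK F FF Fc.
have [k0 _] : [set: K] !=set0 by case: regK => _ _ /infinite_setN0.
pose S := mem_language L; pose atom A : formula K S := mem_atom k0 A.
(* The second kind, applied to [A] and its complement, will decide every set; the third will make
   intersections of fewer than [K] members of [U] nonempty. *)
pose Phi : set (formula K S) := [set phi |
  [\/ exists2 A, F A & phi = atom A,
      exists a (u : seg a -> set L),
        \bigcup_i u i = setT /\ phi = Disj (fun i => atom (u i))
    | exists a (u : seg a -> set L),
        \bigcap_i u i = set0 /\ phi = Neg (Conj (fun i => atom (u i)))]].
have sentPhi : Phi `<=` @sentence d K S.
  move=> _ [[A _ ->]|[a [u [_ ->]]]|[a [u [_ ->]]]].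
  - exact: mem_atom_sentence.
  - by apply: bigcup0 => i _; exact: mem_atom_sentence.
  - by apply: bigcup0 => i _; exact: mem_atom_sentence.
have [|M MP] := compK _ (card_mem_language L) Phi sentPhi.
  move=> Phi' Phi'P /(small_card_lt regK) smallPhi'.
  (* By completeness of [F], the members of [F] asserted in [Phi'] share a point [x], whose
     principal ultrafilter also satisfies the other two kinds. Reading sets off atoms by [g] shows
     that these members are fewer than [K]. *)
  pose g (phi : formula K S) : set L := if phi is Rel A _ then A else setT.
  have [x xP] : (\bigcap_(A in [set A | F A /\ Phi' (atom A)]) A) !=set0.
    apply: complete_nonempty FF Fc _ _; first by move=> A [].
    apply/(small_card_lt regK); apply: sub_small (small_image (f := g) smallPhi').
    by move=> A [_ PA]; exists (atom A).
  exists (point_structure x) => phi Pphi s.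
  have [[A FA e]|[a [u [uT e]]]|[a [u [u0 e]]]] := Phi'P _ Pphi; rewrite e /=.
  - by apply: xP; split => //; rewrite -e.
  - have [i _ ui] : (\bigcup_i u i) x by rewrite uT.
    by exists i.
  - move=> ux; suff : (\bigcap_i u i) x by rewrite u0.
    by move=> i _; exact: ux.
have [m] := dom_inhabited M.
pose s : K -> M := fun=> m.
pose U : set_system L := [set A | sat s (atom A)].
have FU : F `<=` U by move=> A FA; apply: MP; constructor 1; exists A.
have small2 (A B : set L) : small K [set A; B].
  by apply: finite_small => //; exact: finite_set2.
have UVC A : U A \/ U (~` A).
  have [a [u uA]] := small_enum regK (small2 A (~` A)).
  have : sat s (Disj (fun i => atom (u i))).
    apply: MP; constructor 2; exists a, u; split => //.
    by rewrite -(bigcup_image _ u id) uA bigcup_setU !bigcup_set1 setUv.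
  move=> [i]; have : range u (u i) by exists i.
  by rewrite uA => -[] ->; [left|right].
have Ucap D : D `<=` U -> small K D -> (\bigcap_(A in D) A) !=set0.
  move=> DU /(small_enum regK)[a [u uD]].
  apply: contrapT => /set0P/negP/negPn/eqP cap0.
  have : sat s (Neg (Conj (fun i => atom (u i)))).
    apply: MP; constructor 3; exists a, u; split => //.
    by rewrite -(bigcap_image _ u id) uD.
  by apply => i; apply: (DU (u i)); rewrite -uD; exists i.
have Ucomplete D : D `<=` U -> small K D -> U (\bigcap_(A in D) A).
  (* Otherwise the complement of the intersection is in [U], and adding it to [D] gives a small
     family with empty intersection. *)
  move=> DU sD; have [//|UC] := UVC (\bigcap_(A in D) A).
  have [||x xP] := Ucap (D `|` [set ~` \bigcap_(A in D) A]).
  - by move=> A [/DU//|->].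
  - by apply: small_setU => //; apply: finite_small.
  - have /(_ _)[] := xP (~` \bigcap_(A in D) A); first by right.
    by move=> A DA; apply: xP; left.
have US A B : A `<=` B -> U A -> U B.
  move=> AB UA; have [//|UC] := UVC B.
  have [|//|x xP] := Ucap [set A; ~` B]; first by move=> _ [->|->].
  have nBx : ~ B x by apply: (xP (~` B)); right.
  by case: nBx; apply: AB; apply: (xP A); left.
have UP : ProperFilter U.
  split; [|split=> //].
  - move=> U0; have [||x /(_ set0 erefl)//] := Ucap [set set0].
      by move=> _ ->.
    exact: finite_small.
  (* The whole of [L] is the intersection of the empty family. *)
  - by rewrite -(bigcap_set0 id); apply: Ucomplete => //; exact: finite_small.
  - move=> A B UA UB; suff : U (\bigcap_(C in [set A; B]) C).
      by rewrite bigcap_setU !bigcap_set1.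
    by apply: Ucomplete => // _ [->|->].
exists U; split => //.
  (* Since [U] decides every set, a proper filter above [U] with a further member [A] would also
     contain the complement of [A]. *)
  split => // G GF UG; apply/seteqP; split => // A GA.
  have [//|/UG GC] := UVC A.
  by have /filter_ex[x []] : G (A `&` ~` A) by exact: filterI.
by move=> D DU /(small_card_lt regK); exact: Ucomplete.
Qed.

(** * Propositional compactness *)

Section Propositional.
Variables (d : Order.disp_t) (K : orderType d) (L P : Type).
Hypothesis regK : regular_cardinal K.

(** The analogue of the clopen sets of the Cantor cube, which are exactly these for [K] of type
    omega. *)
Definition supported (A : set (P -> Prop)) : Prop :=
  exists2 Q : set P, small K Q &
    forall u v : P -> Prop, (forall p, Q p -> u p = v p) -> A u = A v.

Lemma supported_var p : supported (fun v => v p).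
Proof. by exists [set p]; [exact: finite_small|move=> u v; apply]. Qed.

(** The union of the supports is small by regularity. As [F] is an arbitrary connective, all closure
    properties below are instances. *)
Lemma supported_family I (A : I -> set (P -> Prop)) (F : (I -> Prop) -> Prop) :
  small K [set: I] -> (forall i, supported (A i)) ->
  supported (fun v => F (fun i => A i v)).
Proof.
move=> smallI /(_ _)/cid2-/all_sig2[Q smallQ QA].
exists (\bigcup_i Q i); first exact: small_bigcup.
move=> u v uv; congr F; apply/funext => i; apply: QA => p Qp.
by apply: uv; exists i.
Qed.

Lemma supported2 (F : Prop -> Prop -> Prop) A B :
  supported A -> supported B -> supported (fun v => F (A v) (B v)).
Proof.
move=> sA sB.
apply: (@supported_family bool (fun b => if b then A else B)
  (fun q => F (q true) (q false))); first exact: finite_small.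
by case.
Qed.

Lemma supported_imp A B :
  supported A -> supported B -> supported (fun v => A v -> B v).
Proof. exact: (@supported2 (fun p q => p -> q)). Qed.

Lemma supported_iff A B :
  supported A -> supported B -> supported (fun v => A v <-> B v).
Proof. exact: supported2. Qed.

Lemma supported_not A : supported A -> supported (fun v => ~ A v).
Proof. by move=> sA; exact: (@supported2 (fun p _ => ~ p) A A). Qed.

Lemma supported_forall I (A : I -> set (P -> Prop)) :
  small K [set: I] -> (forall i, supported (A i)) ->
  supported (fun v => forall i, A i v).
Proof. exact: (@supported_family _ _ (fun q => forall i, q i)). Qed.

Lemma supported_exists I (A : I -> set (P -> Prop)) :
  small K [set: I] -> (forall i, supported (A i)) ->
  supported (fun v => exists i, A i v).
Proof. exact: (@supported_family _ _ (fun q => exists i, q i)). Qed.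

(* [box_dense D]: the points [D i] are dense in the product of [P] copies of
   the two-point space, with basic open sets fixing fewer than [K]
   coordinates. *)
Definition box_dense I (D : I -> P -> Prop) : Prop :=
  forall (Q : set P) (g : P -> Prop), small K Q ->
    exists i, forall p, Q p -> D i p = g p.

Lemma propositional_compactness (D : L -> P -> Prop)
    (C : set (set (P -> Prop))) :
  filter_extension_property K L -> box_dense D ->
  C `<=` supported ->
  (forall C' : set (set (P -> Prop)), C' `<=` C -> small K C' ->
    exists v, forall A, C' A -> A v) ->
  exists v, forall A, C A -> A v.
Proof.
move=> fepL denseD suppC locC.
pose F : set_system L := [set X | exists2 C' : set (set (P -> Prop)),
  C' `<=` C /\ small K C' & [set i | forall A, C' A -> A (D i)] `<=` X].
have Fc : complete_system K F.
  move=> E EF /(small_card_lt regK) smallE.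
  have /choice[c cP] X : exists C' : set (set (P -> Prop)), E X ->
      [/\ C' `<=` C, small K C' & [set i | forall A, C' A -> A (D i)] `<=` X].
    have [/EF[C' [? ?] ?]|nEX] := pselect (E X); last by exists set0.
    by exists C'.
  exists (\bigcup_(X in E) c X); first split.
  - by move=> A [X EX cA]; have [cC _ _] := cP X EX; exact: cC.
  - by apply: small_bigcup => // X /cP[].
  - move=> i iP X EX; have [_ _] := cP X EX; apply => A cA; apply: iP.
    by exists X.
have FT : F setT.
  by exists set0 => //; split => //; exact: finite_small.
have FF : ProperFilter F.
  split; [|split=> //].
  (* A small [C'] is satisfied by some [g], and density gives an index whose valuation agrees with
     [g] on the supports of all members of [C']. *)
  - move=> [C' [C'C smallC'] C'0].
    have [g gP] := locC _ C'C smallC'.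
    have /choice[Q QP] A : exists Q : set P, C' A ->
        small K Q /\ forall u v : P -> Prop,
          (forall p, Q p -> u p = v p) -> A u = A v.
      have [/C'C/suppC[Q sQ QA]|nA] := pselect (C' A); last by exists set0.
      by exists Q.
    have [|i iP] := denseD (\bigcup_(A in C') Q A) g.
      by apply: small_bigcup => // A /QP[].
    apply: (C'0 i) => A C'A; have [_ /(_ (D i) g) ->] := QP A C'A.
      exact: gP.
    by move=> p Qp; apply: iP; exists A.
  - move=> X Y FX FY; suff : F (\bigcap_(Z in [set X; Y]) Z).
      by rewrite bigcap_setU !bigcap_set1.
    apply: Fc => [_ [->|->]//|]; apply/(small_card_lt regK).
    by apply: finite_small => //; exact: finite_set2.
  - by move=> X Y XY [C' C'P C'X]; exists C' => // i /C'X/XY.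
have [U [UU Uc FU]] := fepL F FF Fc.
pose v p := U [set i | D i p].
exists v => A CA; have [Q smallQ QA] := suppC A CA.
have UA : U [set i | A (D i)].
  apply: FU; exists [set A]; first by split; [move=> _ ->|exact: finite_small].
  by move=> i; exact.
(* At each coordinate [D i] agrees with [v] for [U]-almost all [i]; completeness of [U] makes this
   simultaneous on the small support [Q]. *)
have UQ : U (\bigcap_(X in (fun p => [set i | D i p = v p]) @` Q) X).
  apply: Uc => [_ [p _ <-]|]; last first.
    exact/(small_card_lt regK)/small_image.
  have [Up|UCp] := in_ultra_setVsetC [set i | D i p] UU.
    by apply: (filterS _ Up) => i /= Dip; apply/propext; split.
  apply: (filterS _ UCp) => i /= nDip; apply/propext; split => // Up.
  by have [j []] := filter_ex (filterI Up UCp).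
have [i [/= Ai iQ]] := filter_ex (filterI UA UQ).
rewrite -(QA (D i) v) // => p Qp.
by apply: (iQ [set i | D i p = v p]); exists p.
Qed.

(* Hausdorff's construction of an independent family: a basic open set is
   described by listing, for each of the fewer than [K] points of
   [L -> bool] that must be sent to True, fewer than [K] of its coordinates,
   enough to separate it from the other points concerned. *)
Lemma box_dense_seq (l0 : L) : embeds P (L -> bool) ->
  exists D : seq_lt K (seq_lt K (L * bool)) -> P -> Prop, box_dense D.
Proof.
move=> [f fI].
exists (fun j p => let: existT a r := j in exists x : seg a,
  let: existT b e := r x in forall y : seg b, f p (e y).1 = (e y).2).
move=> Q g smallQ.
have smallQg : small K (Q `&` g) by apply: sub_small smallQ => p [].
have [a [u uP]] := small_enum regK smallQg.
have [b [w wQ]] := small_enum regK smallQ.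
(* [c] gives a coordinate separating the images of [u x] and [w y] under [f] when these differ; when
   they are equal any coordinate will do, such as [l0]. *)
have /choice[c cP] (xy : seg a * seg b) : exists l : L,
    f (u xy.1) l = f (w xy.2) l -> f (u xy.1) = f (w xy.2).
  have [e|ne] := pselect (f (u xy.1) = f (w xy.2)); first by exists l0.
  apply: contrapT => nl; apply: ne; apply/funext => l.
  by apply: contrapT => nel; apply: nl; exists l.
exists (existT _ a (fun x =>
  existT _ b (fun y => (c (x, y), f (u x) (c (x, y)))))).
move=> p Qp; apply/propext; split=> /= [[x xP]|gp].
  (* A point [p] matching the [x]-th list agrees with [u x] at the coordinate chosen for this very
     pair, hence equals [u x], where [g] is true. *)
  have [y _ yp] : range w p by rewrite wQ.
  have := cP (x, y); rewrite /= yp (xP y) => /(_ erefl)/fI <-.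
  have : range u (u x) by exists x.
  by rewrite uP => -[].
have [x _ xp] : range u p by rewrite uP.
by exists x => y; rewrite xp.
Qed.

End Propositional.

(** * Cardinal arithmetic *)

Section Arithmetic.
Variables (d : Order.disp_t) (K : orderType d).

(** Lookup at any [x : K], with [None] beyond the end, compares sequences without transport along an
    equality of lengths. *)
Definition seq_at A (s : seq_lt K A) (x : K) : option A :=
  omap (projT2 s) (insub x).

Lemma seq_at_inj A (s t : seq_lt K A) :
  projT1 s = projT1 t -> seq_at s =1 seq_at t -> s = t.
Proof.
case: s t => [a u] [b v] /= ab; subst b => uv; congr existT.
apply/funext => i; have := uv (val i); rewrite /seq_at /= valK /=.
by case.
Qed.

Lemma embeds_seq_lt A B : embeds A B -> embeds (seq_lt K A) (seq_lt K B).
Proof.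
move=> [f fI].
exists (fun s => existT (fun a => seg a -> B) (projT1 s) (f \o projT2 s)).
move=> s t st; apply: seq_at_inj; first exact: (congr1 (@projT1 _ _) st).
move=> x; apply: (inj_omap fI).
by have := congr1 (@seq_at B ^~ x) st; rewrite /seq_at /=; do 2 case: insub.
Qed.

Variable L : Type.
Hypothesis regK : regular_cardinal K.
Hypothesis powL : [set: seq_lt K L] #= [set: L].

Lemma embeds_nat_K : embeds nat K.
Proof. by case: regK => _ _ /infiniteP/embeds_card. Qed.

Lemma embeds_pow : embeds (seq_lt K L) L.
Proof. by have /card_eqPle[/embeds_card] := powL. Qed.

(** The empty sequence lies in [seq_lt K L] whatever [L] is. *)
Lemma pow_inhabited : inhabited L.
Proof.
have [_ _ /infinite_setN0 K0 _] := regK; have [a _ amin] := wf_min regK K0.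
have noseg (i : seg a) : False by case: i => x /amin; apply.
have [f _] := embeds_pow.
by exists; exact: f (existT _ a (fun i => False_rect L (noseg i))).
Qed.

(** Constant sequences are told apart by their lengths. *)
Lemma embeds_K_pow : embeds K L.
Proof.
have [l0] := pow_inhabited; apply: embeds_trans embeds_pow.
exists (fun a => existT (fun a => seg a -> L) a (fun=> l0)) => a b.
exact: (congr1 (@projT1 _ _)).
Qed.

Lemma embeds_nat_pow : embeds nat L.
Proof. exact: embeds_trans embeds_nat_K embeds_K_pow. Qed.

Lemma embeds_square_pow : embeds (L * L) L.
Proof.
have [n nI] := embeds_nat_K; apply: embeds_trans embeds_pow.
(* The length [a] lies above two distinct elements of [K], the positions that record the two
   components. *)
have [|a aP] := small_bounded regK (A := [set n 0%N; n 1%N]).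
  by apply: finite_small => //; exact: finite_set2.
have a0 : n 0%N < a by apply: aP; left.
have a1 : n 1%N < a by apply: aP; right.
exists (fun p => existT (fun a => seg a -> L) a
                   (fun i => if sval i == n 0%N then p.1 else p.2)).
move=> [l m] [l' m'] e.
have := congr1 (@seq_at L ^~ (n 0%N)) e; rewrite /seq_at /= insubT /= eqxx.
have := congr1 (@seq_at L ^~ (n 1%N)) e; rewrite /seq_at /= insubT /=.
by rewrite (inj_eq nI) /= => -[->] [->].
Qed.

Lemma embeds_double_pow : embeds (L + L) L.
Proof.
have [n nI] := embeds_nat_pow; apply: embeds_trans embeds_square_pow.
exists (fun x => match x with inl l => (n 0%N, l) | inr l => (n 1%N, l) end).
by move=> [l|l] [m|m] [] // => [->|/nI|/nI|->].
Qed.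

Lemma embeds_prod_pow A B : embeds A L -> embeds B L -> embeds (A * B) L.
Proof.
by move=> AL BL; exact: embeds_trans (embeds_prod AL BL) embeds_square_pow.
Qed.

Lemma embeds_sum_pow A B : embeds A L -> embeds B L -> embeds (A + B) L.
Proof.
by move=> AL BL; exact: embeds_trans (embeds_sum AL BL) embeds_double_pow.
Qed.

Lemma embeds_pow_powerset A : embeds A L -> embeds A (L -> bool).
Proof. by move/embeds_trans; apply; exact: embeds_singletons. Qed.

Lemma embeds_prod_powerset A B :
  embeds A (L -> bool) -> embeds B (L -> bool) -> embeds (A * B) (L -> bool).
Proof.
move=> AL BL; apply: embeds_trans (embeds_prod AL BL) _.
exact: embeds_trans (embeds_exp_prod _ _) (embeds_exp embeds_double_pow).
Qed.

Lemma embeds_sum_powerset A B :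
  embeds A (L -> bool) -> embeds B (L -> bool) -> embeds (A + B) (L -> bool).
Proof.
move=> [f fI] [g gI].
have [||h hI] := @embeds_prod_powerset nat (L -> bool).
- exact/embeds_pow_powerset/embeds_nat_pow.
- by exists id.
exists (fun x => h (match x with inl a => (0%N, f a) | inr b => (1%N, g b) end)).
by move=> [a|b] [a'|b'] /hI [] // => [/fI->|/gI->].
Qed.

(** Absorbing [seq_lt K] into [L] twice reindexes Hausdorff's family by [L]. Spare indices get a
    constant valuation, and a larger family is still dense. *)
Lemma box_dense_pow (P : Type) :
  embeds P (L -> bool) -> exists D : L -> P -> Prop, box_dense K D.
Proof.
move=> PL; have [l0] := pow_inhabited.
have [D denseD] := box_dense_seq regK l0 PL.
have [f fI] : embeds (seq_lt K (seq_lt K (L * bool))) L.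
  apply: embeds_trans embeds_pow; apply: embeds_seq_lt.
  apply: embeds_trans embeds_pow; apply: embeds_seq_lt.
  apply: embeds_prod_pow; first by exists id.
  by apply: embeds_trans embeds_nat_pow; exists nat_of_bool => -[] [].
have [g gK] := injective_option_inv fI.
exists (fun l => if g l is Some j then D j else fun=> True) => Q h smallQ.
have [j jP] := denseD Q h smallQ.
by exists (f j) => p Qp; rewrite gK; exact: jP.
Qed.

End Arithmetic.

(** * Coding of syntax by well-founded trees *)

Section Tree.
Variables (A J : Type).

(** One branching type serves all nodes, so a single counting argument covers every kind of
    syntax. *)
Inductive tree : Type :=
  | Leaf
  | Node (a : A) (c : J -> tree).

(** A tree is coded by a set of addresses in [L]. An address decodes to one of three queries:
    whether there is a node, whether [l'] is in the set coding its label, or the query [l'] put to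
    child [j]. The recursion is on the tree, so decoding need not shorten an address. *)
Lemma embeds_tree (L : Type) :
  embeds A (L -> bool) -> embeds (unit + (L + J * L)) L ->
  embeds tree (L -> bool).
Proof.
move=> [f fI] [e eI]; have [dec decK] := injective_option_inv eI.
pose code := fix code t l :=
  match t with
  | Leaf => false
  | Node a c =>
      match dec l with
      | None => false
      | Some (inl _) => true
      | Some (inr (inl l')) => f a l'
      | Some (inr (inr (j, l'))) => code (c j) l'
      end
  end.
exists code; elim=> [|a c IH] [|b c'] //= tt'.
- by have := congr1 (@^~ (e (inl tt))) tt'; rewrite decK.
- by have := congr1 (@^~ (e (inl tt))) tt'; rewrite decK.
- congr Node.
    apply: fI; apply/funext => l.
    by have := congr1 (@^~ (e (inr (inl l)))) tt'; rewrite decK.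
  apply/funext => j; apply: IH; apply/funext => l.
  by have := congr1 (@^~ (e (inr (inr (j, l))))) tt'; rewrite decK.
Qed.

Lemma Node_label a b c c' : Node a c = Node b c' -> a = b.
Proof. by case. Qed.

(** Pads a family with leaves to the full branching [J]. *)
Definition kids I (e : I -> J) (F : I -> tree) (j : J) : tree :=
  if pselect (exists i, e i = j) is left ex then F (projT1 (cid ex)) else Leaf.

Lemma kids_inj I (e : I -> J) (F G : I -> tree) :
  injective e -> kids e F = kids e G -> F = G.
Proof.
move=> eI FG; apply/funext => i; have := congr1 (@^~ (e i)) FG.
by rewrite /kids; case: pselect => [ex|[]]; [case: cid => j /= /eI->|exists i].
Qed.

End Tree.
Arguments Leaf {A J}.

Section Coding.
Variables (d : Order.disp_t) (K : orderType d) (S : language).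

(* Henkin witnesses: [Skolem X phi s x] is the value at [x] of an assignment
   satisfying [phi] and agreeing with [s] off [X], if there is one. *)
Inductive hterm : Type :=
  | Base
  | HApp (f : fun_sym S) (args : 'I_(fun_arity f) -> hterm)
  | Skolem (X : set K) (phi : formula K S) (s : K -> hterm) (x : K).

(** Satisfaction of every formula under every assignment of Henkin terms is a variable of its own,
    so that each of Tarski's clauses becomes constraints on fewer than [K] variables. *)
Inductive pvar : Type :=
  | PEqual (h h' : hterm)
  | PRel (r : rel_sym S) (args : 'I_(rel_arity r) -> hterm)
  | PSat (phi : formula K S) (s : K -> hterm).

(** The number tells apart the constructors within one kind of syntax. Branches in [nat] hold pairs
    and arguments of symbols, branches in [K] hold families over segments or variables. *)
Let label := (nat * ((fun_sym S + rel_sym S) + (K + unit)))%type.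
Let code := tree label (nat + K).

Let sym_label n f : label := (n, inl f).
Let var_label n x : label := (n, inr (inl x)).
Let nil_label n : label := (n, inr (inr tt)).

Let ord_node a n (F : 'I_n -> code) : code :=
  Node a (kids (fun i : 'I_n => inl (nat_of_ord i)) F).
Let seg_node m (a : K) (F : seg a -> code) : code :=
  Node (var_label m a) (kids (fun i : seg a => inr (sval i)) F).
Let var_node (F : K -> code) : code := Node (nil_label 0) (kids inr F).
Let pair_node a (t u : code) : code :=
  Node a (kids (fun b : bool => inl (nat_of_bool b))
               (fun b => if b then t else u)).

Let ord_node_inj a n (F G : 'I_n -> code) : ord_node a F = ord_node a G -> F = G.
Proof. by case=> /kids_inj; apply=> i j [] /val_inj. Qed.

Let seg_node_inj m (a : K) (F G : seg a -> code) :
  seg_node m F = seg_node m G -> F = G.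
Proof. by case=> /kids_inj; apply=> i j [] /val_inj. Qed.

Let var_node_inj (F G : K -> code) : var_node F = var_node G -> F = G.
Proof. by case=> /kids_inj; apply=> i j []. Qed.

Let pair_node_inj a b t u t' u' :
  pair_node a t u = pair_node b t' u' -> [/\ a = b, t = t' & u = u'].
Proof.
case=> -> /kids_inj e.
have {}e : (fun b : bool => if b then t else u) = (fun b => if b then t' else u').
  by apply: e => -[] [].
by split=> //; [have := congr1 (@^~ true) e|have := congr1 (@^~ false) e].
Qed.

Fixpoint term_code (t : term K S) : code :=
  match t with
  | Var x => Node (var_label 0 x) (fun=> Leaf)
  | App f args => ord_node (sym_label 1 (inl f)) (fun i => term_code (args i))
  end.

Fixpoint formula_code (phi : formula K S) : code :=
  match phi with
  | Equal t u => pair_node (nil_label 0) (term_code t) (term_code u)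
  | Rel r args => ord_node (sym_label 1 (inr r)) (fun i => term_code (args i))
  | Neg phi => Node (nil_label 2) (fun=> formula_code phi)
  | Conj a phi => seg_node 3 (fun i => formula_code (phi i))
  | Disj a phi => seg_node 4 (fun i => formula_code (phi i))
  | All a v phi => pair_node (nil_label 5) (formula_code phi)
      (seg_node 0 (fun i => Node (var_label 0 (v i)) (fun=> Leaf)))
  | Ex a v phi => pair_node (nil_label 6) (formula_code phi)
      (seg_node 0 (fun i => Node (var_label 0 (v i)) (fun=> Leaf)))
  end.

Let set_code (X : set K) : code :=
  Node (nil_label 0) (fun j => if j is inr x then
    if pselect (X x) then Leaf else Node (nil_label 0) (fun=> Leaf) else Leaf).

Fixpoint hterm_code (h : hterm) : code :=
  match h with
  | Base => Leaf
  | HApp f args => ord_node (sym_label 0 (inl f)) (fun i => hterm_code (args i))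
  | Skolem X phi s x => pair_node (var_label 1 x)
      (pair_node (nil_label 0) (set_code X) (formula_code phi))
      (var_node (fun x => hterm_code (s x)))
  end.

Definition pvar_code (p : pvar) : code :=
  match p with
  | PEqual h h' => pair_node (nil_label 0) (hterm_code h) (hterm_code h')
  | PRel r args => ord_node (sym_label 1 (inr r)) (fun i => hterm_code (args i))
  | PSat phi s => pair_node (nil_label 2)
      (formula_code phi) (var_node (fun x => hterm_code (s x)))
  end.

Let set_code_inj : injective set_code.
Proof.
move=> X Y [XY]; apply/funext => x; apply/propext.
have := congr1 (@^~ (inr x)) XY => /=.
by do 2 case: pselect.
Qed.

Lemma term_code_inj : injective term_code.
Proof.
elim=> [x|f args IH] [y|g args'] //=; first by case=> ->.
move=> e; have [fg] := Node_label e; subst g; congr App.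
by apply/funext => i; apply/IH/(congr1 (@^~ i) (ord_node_inj e)).
Qed.

Lemma formula_code_inj : injective formula_code.
Proof.
elim=> [t u|r args|phi IH|a phi IH|a phi IH|a v phi IH|a v phi IH]
  [t' u'|r' args'|phi'|a' phi'|a' phi'|a' v' phi'|a' v' phi'] //= e;
  have // el := Node_label e.
- by have [_ /term_code_inj-> /term_code_inj->] := pair_node_inj e.
- case: el => rr'; subst r'; congr Rel; apply/funext => i.
  exact/term_code_inj/(congr1 (@^~ i) (ord_node_inj e)).
- by case: e => /(congr1 (@^~ (inl 0%N)))/IH->.
- case: el => aa'; subst a'; congr Conj; apply/funext => i.
  exact/IH/(congr1 (@^~ i) (seg_node_inj e)).
- case: el => aa'; subst a'; congr Disj; apply/funext => i.
  exact/IH/(congr1 (@^~ i) (seg_node_inj e)).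
- have [_ /IH <- ev] := pair_node_inj e; have [aa'] := Node_label ev; subst a'.
  congr All; apply/funext => i.
  by have [] := Node_label (congr1 (@^~ i) (seg_node_inj ev)).
- have [_ /IH <- ev] := pair_node_inj e; have [aa'] := Node_label ev; subst a'.
  congr Ex; apply/funext => i.
  by have [] := Node_label (congr1 (@^~ i) (seg_node_inj ev)).
Qed.

Lemma hterm_code_inj : injective hterm_code.
Proof.
elim=> [|f args IH|X phi s IH x] [|g args'|X' phi' s' x'] //= e;
  have // el := Node_label e.
- case: el => fg; subst g; congr HApp; apply/funext => i.
  exact/IH/(congr1 (@^~ i) (ord_node_inj e)).
- case: el => <-; have [_ eX es] := pair_node_inj e.
  have [_ /set_code_inj <- /formula_code_inj <-] := pair_node_inj eX.
  congr Skolem; apply/funext => y.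
  exact/IH/(congr1 (@^~ y) (var_node_inj es)).
Qed.

Lemma pvar_code_inj : injective pvar_code.
Proof.
move=> [h h'|r args|phi s] [g g'|r' args'|phi' s'] //= e;
  have // el := Node_label e.
- by have [_ /hterm_code_inj-> /hterm_code_inj->] := pair_node_inj e.
- case: el => rr'; subst r'; congr PRel; apply/funext => i.
  exact/hterm_code_inj/(congr1 (@^~ i) (ord_node_inj e)).
- have [_ /formula_code_inj <- es] := pair_node_inj e.
  congr PSat; apply/funext => y.
  exact/hterm_code_inj/(congr1 (@^~ y) (var_node_inj es)).
Qed.

(** Codes have at most 2^L labels, and their branching [nat + K] embeds into [L]. *)
Lemma embeds_pvar (L : Type) :
  regular_cardinal K -> [set: seq_lt K L] #= [set: L] ->
  embeds (fun_sym S + rel_sym S) (L -> bool) -> embeds pvar (L -> bool).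
Proof.
move=> regK powL symL.
have natL := embeds_nat_pow regK powL; have KL := embeds_K_pow regK powL.
have unitL : embeds unit L.
  by apply: embeds_trans natL; exists (fun=> 0%N) => -[] [].
have idL : embeds L L by exists id.
have LP A : embeds A L -> embeds A (L -> bool).
  exact: embeds_pow_powerset.
apply: (@embeds_trans code); first by exists pvar_code; exact: pvar_code_inj.
apply: embeds_tree.
- apply: (embeds_prod_powerset regK powL (LP _ natL)).
  apply: (embeds_sum_powerset regK powL symL).
  exact: (embeds_sum_powerset regK powL (LP _ KL) (LP _ unitL)).
- apply: (embeds_sum_pow regK powL unitL).
  apply: (embeds_sum_pow regK powL idL).
  apply: (embeds_prod_pow regK powL _ idL).
  exact: (embeds_sum_pow regK powL natL KL).
Qed.

End Coding.

(** * Filter extension implies compactness *)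

Section Henkin.
Variables (d : Order.disp_t) (K : orderType d) (S : language).
Local Notation hterm := (hterm K S).

(** Off [X] the terms of [s] are kept, so that agreement off [X] holds between the terms themselves
    and not only between their values. *)
Definition hwitness (X : set K) phi (s : K -> hterm) (x : K) : hterm :=
  if pselect (X x) then Skolem X phi s x else s x.

Fixpoint heval (s : K -> hterm) (t : term K S) : hterm :=
  match t with
  | Var x => s x
  | App f args => HApp (fun i => heval s (args i))
  end.

Section Interpretation.
Variables (M : structure S) (m0 : M).

(** A Skolem function obtained by choice. The default [s] preserves agreement off [X] when there is
    no witness. *)
Definition witness (X : set K) phi (s : K -> M) : K -> M :=
  if pselect (exists2 s', agree_off X s s' & sat s' phi) is left ex
  then s2val (cid2 ex) else s.

Lemma witness_off X phi s : agree_off X s (witness X phi s).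
Proof. by rewrite /witness; case: pselect => // ex; case: cid2. Qed.

Lemma witness_sat X phi s s' :
  agree_off X s s' -> sat s' phi -> sat (witness X phi s) phi.
Proof.
move=> ss' s'phi; rewrite /witness; case: pselect => [ex|[]]; first by case: cid2.
by exists s'.
Qed.

Fixpoint interp (h : hterm) : M :=
  match h with
  | Base => m0
  | HApp f args => fun_interp (fun i => interp (args i))
  | Skolem X phi s x => witness X phi (fun y => interp (s y)) x
  end.

Lemma interp_heval s t : interp (heval s t) = eval (interp \o s) t.
Proof.
by elim: t => //= f args IH; congr fun_interp; apply/funext => i; exact: IH.
Qed.

Lemma interp_hwitness X phi s :
  interp \o hwitness X phi s = witness X phi (interp \o s).
Proof.
apply/funext => x; rewrite /= /hwitness; case: pselect => //= nXx.
by rewrite (witness_off phi (interp \o s) nXx).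
Qed.

Definition valuation (p : pvar K S) : Prop :=
  match p with
  | PEqual h h' => interp h = interp h'
  | PRel r args => rel_interp (interp \o args)
  | PSat phi s => sat (interp \o s) phi
  end.

End Interpretation.

Hypothesis regK : regular_cardinal K.
Variable v : pvar K S -> Prop.
(** A transfer principle: each rule below is checked in actual structures and passes to [v] because
    it involves fewer than [K] variables. *)
Hypothesis vP : forall A : set (pvar K S -> Prop),
  supported K A -> (forall (M : structure S) (m0 : M), A (valuation m0)) -> A v.

Let svar := @supported_var d K (pvar K S) regK.
Let simp := @supported_imp d K (pvar K S) regK.
Let siff := @supported_iff d K (pvar K S) regK.
Let sall := @supported_forall d K (pvar K S) regK.

Let small_ord n : small K [set: 'I_n].
Proof. exact: finite_small. Qed.

Let vrefl h : v (PEqual h h).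
Proof. exact: (vP (svar _)). Qed.

Let vsym h h' : v (PEqual h h') -> v (PEqual h' h).
Proof. by apply: (vP (simp (svar _) (svar _))). Qed.

Let vtrans h1 h2 h3 :
  v (PEqual h1 h2) -> v (PEqual h2 h3) -> v (PEqual h1 h3).
Proof.
by apply: (vP (simp (svar _) (simp (svar _) (svar _)))) => M m0 /= -> ->.
Qed.

Let vapp f (args args' : 'I_(fun_arity f) -> hterm) :
  (forall i, v (PEqual (args i) (args' i))) ->
  v (PEqual (HApp args) (HApp args')).
Proof.
apply: (vP (simp (sall (@small_ord _)
  (fun i => svar (PEqual (args i) (args' i)))) (svar _))).
by move=> M m0 /= e; congr fun_interp; apply/funext.
Qed.

Let vrel r (args args' : 'I_(rel_arity r) -> hterm) :
  (forall i, v (PEqual (args i) (args' i))) ->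
  v (PRel args) -> v (PRel args').
Proof.
apply: (vP (simp (sall (@small_ord _)
  (fun i => svar (PEqual (args i) (args' i))))
                 (simp (svar _) (svar _)))).
move=> M m0 /= e; suff -> : interp m0 \o args = interp m0 \o args' by [].
exact/funext.
Qed.

Let vEqual s t u :
  v (PSat (Equal t u) s) <-> v (PEqual (heval s t) (heval s u)).
Proof.
by apply: (vP (siff (svar _) (svar _))) => M m0 /=; rewrite !interp_heval.
Qed.

Let vRel s r (args : 'I_(rel_arity r) -> term K S) :
  v (PSat (Rel args) s) <-> v (PRel (heval s \o args)).
Proof.
apply: (vP (siff (svar _) (svar _))) => M m0 /=.
suff -> : interp m0 \o (heval s \o args) =
          (fun i => eval (interp m0 \o s) (args i)) by [].
by apply/funext => i /=; rewrite interp_heval.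
Qed.

Let vNeg s phi : v (PSat (Neg phi) s) <-> ~ v (PSat phi s).
Proof. by apply: (vP (siff (svar _) (supported_not regK (svar _)))). Qed.

Let vConj s a (phi : seg a -> formula K S) :
  v (PSat (Conj phi) s) <-> forall i, v (PSat (phi i) s).
Proof.
by apply: (vP (siff (svar _) (sall (@small_seg _ _ regK a)
  (fun i => svar (PSat (phi i) s))))).
Qed.

Let vDisj s a (phi : seg a -> formula K S) :
  v (PSat (Disj phi) s) <-> exists i, v (PSat (phi i) s).
Proof.
by apply: (vP (siff (svar _)
  (supported_exists regK (@small_seg _ _ regK a)
  (fun i => svar (PSat (phi i) s))))).
Qed.

Let agree_interp (M : structure S) (m0 : M) X (s s' : K -> hterm) :
  (forall x, ~ X x -> s' x = s x) ->
  agree_off X (interp m0 \o s) (interp m0 \o s').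
Proof. by move=> ss' x nXx /=; rewrite ss'. Qed.

Let vAll_inst s s' a (u : seg a -> K) phi :
  (forall x, ~ range u x -> s' x = s x) ->
  v (PSat (All u phi) s) -> v (PSat phi s').
Proof.
move=> ss'; apply: (vP (simp (svar _) (svar _))) => M m0 /=.
by apply; exact: agree_interp.
Qed.

(** If there is a counterexample, the Skolem witness for [Neg phi] is one, so a single assignment
    tests the whole quantifier block. *)
Let vAll_wit s a (u : seg a -> K) phi :
  v (PSat phi (hwitness (range u) (Neg phi) s)) -> v (PSat (All u phi) s).
Proof.
apply: (vP (simp (svar _) (svar _))) => M m0 /=; rewrite interp_hwitness => wphi.
move=> s' ss'; apply: contrapT => ns'phi.
exact: (witness_sat (phi := Neg phi) ss' ns'phi).
Qed.

Let vEx_inst s s' a (u : seg a -> K) phi :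
  (forall x, ~ range u x -> s' x = s x) ->
  v (PSat phi s') -> v (PSat (Ex u phi) s).
Proof.
move=> ss'; apply: (vP (simp (svar _) (svar _))) => M m0 /= s'phi.
by exists (interp m0 \o s') => //; exact: agree_interp.
Qed.

Let vEx_wit s a (u : seg a -> K) phi :
  v (PSat (Ex u phi) s) -> v (PSat phi (hwitness (range u) phi s)).
Proof.
apply: (vP (simp (svar _) (svar _))) => M m0 /= [s' ss' s'phi].
by rewrite interp_hwitness; exact: witness_sat ss' s'phi.
Qed.

Definition hclass (h : hterm) : set hterm := [set h' | v (PEqual h h')].

Definition hdom : Type := {C : set hterm | exists h, C = hclass h}.

Definition hcl (h : hterm) : hdom := exist _ (hclass h) (ex_intro _ h erefl).

Definition hrep (c : hdom) : hterm := projT1 (cid (svalP c)).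

Lemma hcl_eq h h' : hcl h = hcl h' <-> v (PEqual h h').
Proof.
split=> [/(congr1 sval)/= e|e].
  by have : hclass h' h' := vrefl h'; rewrite -e.
apply: eq_exist; apply/funext => g; apply/propext; split.
  exact/vtrans/vsym.
exact: vtrans.
Qed.

Lemma hrepK c : hcl (hrep c) = c.
Proof.
rewrite /hrep; case: cid => h /= e; case: c e => C hC /= e.
exact: eq_exist.
Qed.

(** Symbols are interpreted through chosen representatives; the congruence rules [vapp] and [vrel]
    make the choice immaterial. *)
Definition henkin_structure : structure S :=
  @Structure S hdom (inhabits (hcl (Base K S)))
    (fun f args => hcl (HApp (hrep \o args)))
    (fun r args => v (PRel (hrep \o args))).

Local Notation MH := henkin_structure.

Lemma eval_henkin s t : @eval d K S MH (hcl \o s) t = hcl (heval s t).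
Proof.
elim: t => //= f args IH; apply/hcl_eq/vapp => i /=.
by apply/hcl_eq; rewrite hrepK; exact: IH.
Qed.

(** Representatives are taken only on [X]; elsewhere the terms of [s] stay, as [vAll_inst] and
    [vEx_inst] require. *)
Lemma lift_assignment X (s : K -> hterm) (t : K -> MH) :
  agree_off X (hcl \o s : K -> MH) t ->
  exists2 s' : K -> hterm, (forall x, ~ X x -> s' x = s x) & t = hcl \o s'.
Proof.
move=> st; exists (fun x => if pselect (X x) then hrep (t x) else s x).
  by move=> x nXx; case: pselect.
by apply/funext => x /=; case: pselect => [Xx|nXx]; [rewrite hrepK|exact: st].
Qed.

Lemma hwitness_off X phi s x : ~ X x -> hwitness X phi s x = s x.
Proof. by rewrite /hwitness; case: pselect. Qed.

(** The truth lemma of Henkin's method. The induction is for all [s] at once, since quantifiers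
    change the assignment. *)
Lemma sat_henkin phi s : @sat d K S MH (hcl \o s) phi <-> v (PSat phi s).
Proof.
elim: phi s => [t u|r args|phi IH|a phi IH|a phi IH|a u phi IH|a u phi IH] s /=.
- by rewrite !eval_henkin vEqual hcl_eq.
- rewrite vRel; split; apply: vrel => i /=; apply/hcl_eq;
    by rewrite hrepK eval_henkin.
- by rewrite vNeg IH.
- by rewrite vConj; split=> sphi i; apply/IH.
- by rewrite vDisj; split=> -[i /IH]; exists i.
- split=> [sphi|vphi t /lift_assignment[s' ss' ->]].
    apply/vAll_wit/IH/sphi => x nXx /=; rewrite hwitness_off//.
  exact/IH/(vAll_inst ss').
- split=> [[t /lift_assignment[s' ss' ->] /IH]|vphi].
    exact: vEx_inst.
  exists (hcl \o hwitness (range u) phi s); last exact/IH/vEx_wit.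
  by move=> x nXx /=; rewrite hwitness_off.
Qed.

End Henkin.

Lemma compactness_of_filter_extension (d : Order.disp_t) (K : orderType d)
    (L : Type) :
  regular_cardinal K -> [set: seq_lt K L] #= [set: L] ->
  filter_extension_property K L -> compactness_property K (L -> bool).
Proof.
move=> regK powL fepL S /card_eqPle[/embeds_card symL _] Phi _ locPhi.
have [D denseD] := box_dense_pow regK powL (embeds_pvar regK powL symL).
pose valid (Psi : set (formula K S)) (A : set (pvar K S -> Prop)) :=
  forall (M : structure S) (m0 : M),
    (forall phi, Psi phi -> forall s : K -> M, sat s phi) -> A (valuation m0).
(* The constraints are the consequences, on fewer than [K] variables, of small subsets of [Phi].
   Fewer than [K] of them follow from one small subset of [Phi], whose model induces a valuation
   satisfying them. *)
pose C : set (set (pvar K S -> Prop)) := [set A | supported K A /\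
  exists2 Psi, Psi `<=` Phi /\ small K Psi & valid Psi A].
have [||v vC] := propositional_compactness regK (C := C) fepL denseD.
- by move=> A [].
- move=> C' C'C smallC'.
  have /choice[psi psiP] A : exists Psi : set (formula K S), C' A ->
      [/\ Psi `<=` Phi, small K Psi & valid Psi A].
    have [/C'C[_ [Psi [? ?] ?]]|nA] := pselect (C' A); last by exists set0.
    by exists Psi.
  have [||M MP] := locPhi (\bigcup_(A in C') psi A).
  + by move=> phi [A /psiP[psiPhi _ _] /psiPhi].
  + by apply/(small_card_lt regK)/small_bigcup => // A /psiP[].
  + have [m0] := dom_inhabited M.
    exists (valuation m0) => A C'A; have [_ _] := psiP A C'A; apply.
    by move=> phi phiA; apply: MP; exists A.
(* Constraints valid in all structures belong to [C] through the empty subset of [Phi]. *)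
have vP A : supported K A ->
    (forall (M : structure S) (m0 : M), A (valuation m0)) -> A v.
  move=> suppA validA; apply: vC; split => //.
  by exists set0; [split => //; exact: finite_small|move=> M m0 _].
exists (henkin_structure v) => phi Phiphi t.
have -> : t = @hcl d K S v \o (@hrep d K S v \o t).
  by apply/funext => x /=; rewrite hrepK.
apply/(sat_henkin regK vP).
(* The subset consisting of [phi] alone forces this variable to be true. *)
apply: (vC (fun w => w (PSat phi _))); split; first exact: supported_var.
exists [set phi]; first by split; [move=> _ ->|exact: finite_small].
by move=> M m0 /(_ phi erefl); exact.
Qed.

Theorem theorem2p2 (d : Order.disp_t) (K : orderType d) (L : Type)
    (regK : regular_cardinal K)
    (powL : [set: seq_lt K L] #= [set: L]) :
  filter_extension_property K L <-> compactness_property K (L -> bool).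
Proof.
split; first exact: compactness_of_filter_extension.
exact: filter_extension_of_compactness.
Qed.
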